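(* Let $Q$ be an $s\times t$ $(0,1)$-matrix that is not all-zero, and let its core $Q_{core}$ be an $s'\times t'$ matrix. If $m-(s-s')\ge 2s'$ and $n-(t-t')\ge 2t'$, then \[\mathrm{m}(m,n,Q)=\bigl(m-(s-s')\bigr)\bigl(n-(t-t')\bigr)-\bigl(|NW(Q_{core})|+|SW(Q_{core})|+|NE(Q_{core})|+|SE(Q_{core})|\bigr).\]
   Context: All matrices are $(0,1)$-matrices. An $m\times n$ matrix $A$ is $Q$-forcing if every $s\times t$ submatrix of $A$ (any $s$ rows and any $t$ columns, order kept) is entrywise $\ge Q$; $\mathrm{m}(m,n,Q)$ is the minimum number of $1$-entries of an $m\times n$ $Q$-forcing matrix. $Q_{core}$ is obtained from $Q$ by deleting all-zero rows from the top and bottom and all-zero columns from the left and right until each of its first row, last row, first column and last column contains a $1$-entry. For a matrix $R$, the corner functions are: $NW(R)$ is the set of positions $(i,j)$ with $R_{i,j}=0$ such that no $1$-entry of $R$ lies at a position $(i',j')$ with $i'\le i$, $j'\le j$; $SW(R)$: same with $i'\ge i$, $j'\le j$; $NE(R)$: same with $i'\le i$, $j'\ge j$; $SE(R)$: same with $i'\ge i$, $j'\ge j$. $|X|$ denotes cardinality. *)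

(* Defs.v *)
(* (0,1)-matrices are boolean matrices, [true] standing for 1; indices start
   at 0. *)
From mathcomp Require Import all_boot all_order all_algebra.

Set Implicit Arguments.
Unset Strict Implicit.
Unset Printing Implicit Defensive.

Local Open Scope nat_scope.

Definition num_ones m n (A : 'M[bool]_(m, n)) : nat :=
  #|[set p : 'I_m * 'I_n | A p.1 p.2]|.

Definition incr_ffun s m (f : {ffun 'I_s -> 'I_m}) : bool :=
  [forall i1 : 'I_s, forall i2 : 'I_s, (i1 < i2) ==> (f i1 < f i2)].

Definition entrywise_le s t (Q B : 'M[bool]_(s, t)) : bool :=
  [forall i : 'I_s, forall j : 'I_t, Q i j <= B i j].

(* A choice of s rows of A in order is an increasing map f : 'I_s -> 'I_m, and
   likewise for columns. *)
Definition Q_forcing s t (Q : 'M[bool]_(s, t)) m n (A : 'M[bool]_(m, n)) : bool :=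
  [forall f : {ffun 'I_s -> 'I_m}, forall g : {ffun 'I_t -> 'I_n},
     incr_ffun f && incr_ffun g ==> entrywise_le Q (mxsub f g A)].

Lemma Q_forcing_all_ones s t (Q : 'M[bool]_(s, t)) m n :
  Q_forcing Q (const_mx true : 'M[bool]_(m, n)).
Proof.
apply/forallP=> f; apply/forallP=> g; apply/implyP=> _.
by apply/forallP=> i; apply/forallP=> j; rewrite !mxE leq_b1.
Qed.

(* The default of the arg min is Q-forcing, so the minimum is attained on the
   intended set; see [min_onesP]. *)
Definition min_ones m n s t (Q : 'M[bool]_(s, t)) : nat :=
  num_ones [arg min_(A < (const_mx true : 'M[bool]_(m, n)) | Q_forcing Q A)
              num_ones A].

Lemma min_onesP m n s t (Q : 'M[bool]_(s, t)) :
  (exists2 A : 'M[bool]_(m, n), Q_forcing Q A & num_ones A = min_ones m n Q) /\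
  (forall A : 'M[bool]_(m, n), Q_forcing Q A -> min_ones m n Q <= num_ones A).
Proof.
rewrite /min_ones; case: arg_minnP => [|A QA minA]; first exact: Q_forcing_all_ones.
by split; first exists A.
Qed.

Definition row_has_one s t (Q : 'M[bool]_(s, t)) (i : 'I_s) : bool :=
  [exists j : 'I_t, Q i j].

(* Lengths of the maximal blocks of consecutive all-zero rows at the top and at
   the bottom, and of all-zero columns at the left and at the right. *)
Definition zero_top s t (Q : 'M[bool]_(s, t)) : nat :=
  find (row_has_one Q) (enum 'I_s).
Definition zero_bottom s t (Q : 'M[bool]_(s, t)) : nat :=
  find (row_has_one Q) (rev (enum 'I_s)).
Definition zero_left s t (Q : 'M[bool]_(s, t)) : nat := zero_top Q^T%R.
Definition zero_right s t (Q : 'M[bool]_(s, t)) : nat := zero_bottom Q^T%R.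

Lemma trim_ord_subproof s a b (i : 'I_(s - a - b)) : a + i < s.
Proof. by rewrite -ltn_subRL (leq_trans (ltn_ord i)) ?leq_subr. Qed.

(* Index in the original of the i-th row left after deleting the first a and the
   last b of s rows. *)
Definition trim_ord s a b (i : 'I_(s - a - b)) : 'I_s :=
  Ordinal (trim_ord_subproof i).

Definition core_rows s t (Q : 'M[bool]_(s, t)) : nat :=
  s - zero_top Q - zero_bottom Q.
Definition core_cols s t (Q : 'M[bool]_(s, t)) : nat :=
  t - zero_left Q - zero_right Q.

(* Deleting all-zero columns does not change which rows are all-zero, nor
   conversely, so the four trimmings can be done at once. *)
Definition core s t (Q : 'M[bool]_(s, t)) :
    'M[bool]_(core_rows Q, core_cols Q) :=
  mxsub (@trim_ord s (zero_top Q) (zero_bottom Q))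
        (@trim_ord t (zero_left Q) (zero_right Q)) Q.

Definition NW s t (R : 'M[bool]_(s, t)) : {set 'I_s * 'I_t} :=
  [set p | ~~ R p.1 p.2 &
     ~~ [exists q : 'I_s * 'I_t, [&& R q.1 q.2, q.1 <= p.1 & q.2 <= p.2]]].
Definition SW s t (R : 'M[bool]_(s, t)) : {set 'I_s * 'I_t} :=
  [set p | ~~ R p.1 p.2 &
     ~~ [exists q : 'I_s * 'I_t, [&& R q.1 q.2, q.1 >= p.1 & q.2 <= p.2]]].
Definition NE s t (R : 'M[bool]_(s, t)) : {set 'I_s * 'I_t} :=
  [set p | ~~ R p.1 p.2 &
     ~~ [exists q : 'I_s * 'I_t, [&& R q.1 q.2, q.1 <= p.1 & q.2 >= p.2]]].
Definition SE s t (R : 'M[bool]_(s, t)) : {set 'I_s * 'I_t} :=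
  [set p | ~~ R p.1 p.2 &
     ~~ [exists q : 'I_s * 'I_t, [&& R q.1 q.2, q.1 >= p.1 & q.2 >= p.2]]].

(* Main.v *)
Require Import Defs.
From mathcomp Require Import all_boot all_order all_algebra.
From mathcomp Require Import zify.

Set Implicit Arguments.
Unset Strict Implicit.
Unset Printing Implicit Defensive.

Import Order.TTheory GRing.Theory Num.Theory.

(** A 1-entry of [Q] at [(i, j)] can be aligned with the position [(x, y)]
    exactly when [i <= x <= m - s + i] and [j <= y <= n - t + j], so the least
    [Q]-forcing matrix is the indicator of a union of translated boxes.  All
    these boxes lie in a window of [m - (s - s')] rows and [n - (t - t')]
    columns; as [m - s >= s'] and [n - t >= t'], the uncovered part of the
    window splits into its four corner [s' x t'] blocks, where it is a copy of
    [NW], [SW], [NE] and [SE] of the core. *)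

Definition forced s t (Q : 'M[bool]_(s, t)) (M N x y : nat) : bool :=
  [exists p : 'I_s * 'I_t,
     [&& Q p.1 p.2, p.1 <= x <= M + p.1 & p.2 <= y <= N + p.2]].

(** * Increasing maps and the least forcing matrix *)

(** The [i] chosen indices before [f i] and the [s - i.+1] after it are distinct from it and must
    fit into ['I_m]. *)
Lemma incr_ffun_bounds s m (f : {ffun 'I_s -> 'I_m}) (i : 'I_s) :
  incr_ffun f -> i <= f i <= m - s + i.
Proof.
move=> /forallP fP.
have incr (i1 i2 : 'I_s) : i1 < i2 -> f i1 < f i2.
  by move=> lt12; have /forallP/(_ i2)/implyP/(_ lt12) := fP i1.
have lo k (ks : k < s) : k <= f (Ordinal ks).
  elim: k ks => // k IHk ks.
  have := IHk (ltnW ks); have := @incr (Ordinal (ltnW ks)) (Ordinal ks).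
  by rewrite /= ltnSn => /(_ isT); lia.
(* Index [s - k.+1] is the [k]-th from the end, so descending induction becomes induction on [k]. *)
have hi k (ks : s - k.+1 < s) : k < s -> f (Ordinal ks) + k < m.
  elim: k ks => [|k IHk] ks k_lt; first by rewrite addn0.
  have ks' : s - k.+1 < s by lia.
  have := IHk ks' (ltnW k_lt); have := @incr (Ordinal ks) (Ordinal ks').
  by rewrite /=; lia.
have := lo i (ltn_ord i); have -> : Ordinal (ltn_ord i) = i by exact: val_inj.
move=> -> /=; have i_lt := ltn_ord i.
have ks : s - (s - i.+1).+1 < s by lia.
have := hi _ ks; have -> : Ordinal ks = i by apply: val_inj => /=; lia.
by lia.
Qed.

(** The map is the identity before [i] and the shift by [x - i] from [i] on; its largest value stays
    below [m] because [x <= m - s + i]. *)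
Lemma incr_ffun_through s m (i : 'I_s) (x : 'I_m) :
  s <= m -> i <= x <= m - s + i ->
  exists2 f : {ffun 'I_s -> 'I_m}, incr_ffun f & f i = x.
Proof.
move=> le_sm /andP[le_ix le_x].
have fP (k : 'I_s) : (if k < i then k : nat else k + (x - i)) < m.
  by have := ltn_ord k; case: ifP; lia.
exists [ffun k => Ordinal (fP k)].
  apply/forallP => k1; apply/forallP => k2; apply/implyP => lt12.
  by rewrite !ffunE /=; case: ifP; case: ifP; lia.
by apply: val_inj; rewrite ffunE /= ltnn subnKC.
Qed.

(** Rows and columns are chosen independently, so the two coordinate bounds can be realised
    simultaneously. *)
Lemma Q_forcingP s t (Q : 'M[bool]_(s, t)) m n (A : 'M[bool]_(m, n)) :
  s <= m -> t <= n ->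
  reflect (forall (x : 'I_m) (y : 'I_n), forced Q (m - s) (n - t) x y -> A x y)
          (Q_forcing Q A).
Proof.
move=> le_sm le_tn; apply: (iffP idP) => [/forallP QA x y|QA].
  case/existsP=> -[i j] /= /and3P[Qij bx yb].
  have [f f_incr <-] := incr_ffun_through le_sm bx.
  have [g g_incr <-] := incr_ffun_through le_tn yb.
  have /forallP/(_ g) := QA f; rewrite f_incr g_incr /=.
  by move=> /forallP/(_ i)/forallP/(_ j); rewrite mxE Qij; case: (A _ _).
apply/forallP => f; apply/forallP => g; apply/implyP => /andP[f_incr g_incr].
apply/forallP => i; apply/forallP => j; rewrite mxE.
case Qij: (Q i j) => //; rewrite QA //; apply/existsP; exists (i, j).
by rewrite Qij !incr_ffun_bounds.
Qed.

Lemma card_set_pair m n (P : 'I_m -> 'I_n -> bool) :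
  #|[set p | P p.1 p.2]| = \sum_(i < m) \sum_(j < n) P i j.
Proof.
rewrite -sum1_card pair_big /= big_mkcond /=.
by apply: eq_bigr => p _; rewrite inE; case: (P _ _).
Qed.

(** The indicator of the forced positions is itself forcing and lies entrywise below every forcing
    matrix, so it attains the minimum. *)
Lemma min_ones_forced m n s t (Q : 'M[bool]_(s, t)) :
  s <= m -> t <= n ->
  min_ones m n Q =
    \sum_(0 <= x < m) \sum_(0 <= y < n) forced Q (m - s) (n - t) x y.
Proof.
move=> le_sm le_tn; have [[A QA <-] minA] := min_onesP m n Q.
pose B : 'M[bool]_(m, n) := (\matrix_(x, y) forced Q (m - s) (n - t) x y)%R.
have -> : num_ones A = num_ones B.
  apply/eqP; rewrite eqn_leq; apply/andP; split.
    by apply: minA; apply/Q_forcingP => // x y; rewrite mxE.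
  apply: subset_leq_card; apply/subsetP => -[x y]; rewrite !inE mxE /=.
  by move: x y; apply/Q_forcingP.
rewrite /num_ones card_set_pair big_mkord; apply: eq_bigr => x _.
by rewrite big_mkord; apply: eq_bigr => y _; rewrite mxE.
Qed.

(** * Sums supported on a window or on two end segments *)

Lemma sum_nat0 (h : nat -> nat) l u :
  (forall x, l <= x < u -> h x = 0) -> \sum_(l <= x < u) h x = 0.
Proof. by move=> h0; rewrite big_nat big1. Qed.

Lemma sum_window (h : nat -> nat) a k m :
  a + k <= m -> (forall x, h x != 0 -> a <= x < a + k) ->
  \sum_(0 <= x < m) h x = \sum_(0 <= x < k) h (a + x).
Proof.
move=> le_m h0; rewrite (@big_cat_nat _ _ _ a) //=; last by lia.
rewrite (@big_cat_nat _ _ _ (a + k) a m) //=; last by lia.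
rewrite (@sum_nat0 h 0 a) => [|x x_lt]; last by have := h0 x; lia.
rewrite (@sum_nat0 h (a + k) m) => [|x x_lt]; last by have := h0 x; lia.
rewrite addn0 add0n -{1}[a]add0n big_addn addKn.
by apply: eq_bigr => x _; rewrite addnC.
Qed.

Lemma sum_two_ends (h : nat -> nat) M k :
  k <= M -> (forall x, k <= x < M -> h x = 0) ->
  \sum_(0 <= x < M + k) h x = \sum_(i < k) (h i + h (M + i)).
Proof.
move=> le_kM h0; rewrite (@big_cat_nat _ _ _ k) //=; last by lia.
rewrite (@big_cat_nat _ _ _ M k) //=; last by lia.
rewrite (@sum_nat0 h k M) // add0n -{1}[M]add0n big_addn addKn.
rewrite !big_mkord big_split /=; congr (_ + _).
by apply: eq_bigr => x _; rewrite addnC.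
Qed.

(** * Uncovered positions and the corner functions *)

(** Treats the four corner functions at once, [r] and [c] being the directions searched for
    1-entries. By reflexivity a 1-entry at [p] is its own witness [q], so both sides count 0
    there. *)
Lemma card_corner s t (R : 'M[bool]_(s, t)) (r c : rel nat) :
  reflexive r -> reflexive c ->
  #|[set p | ~~ R p.1 p.2 &
      ~~ [exists q : 'I_s * 'I_t, [&& R q.1 q.2, r q.1 p.1 & c q.2 p.2]]]| =
  \sum_(i < s) \sum_(j < t)
     ~~ [exists q : 'I_s * 'I_t, [&& R q.1 q.2, r q.1 i & c q.2 j]].
Proof.
move=> rr cc; rewrite -card_set_pair; apply: eq_card => -[i j]; rewrite !inE /=.
case Rij: (R i j) => //=; apply/esym/negbTE; rewrite negbK.
by apply/existsP; exists (i, j); rewrite Rij rr cc.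
Qed.

(** The nonzero border lines of [R] cover all middle rows and columns. In each of the four remaining
    blocks, two of the four box inequalities hold automatically, as indices of [R] are below
    [s <= M] and [t <= N]; the other two define the corner function. *)
Lemma sum_unforced s t (R : 'M[bool]_(s, t)) M N :
  s <= M -> t <= N ->
  (forall i : 'I_s, i = 0 :> nat \/ i.+1 = s -> exists j, R i j) ->
  (forall j : 'I_t, j = 0 :> nat \/ j.+1 = t -> exists i, R i j) ->
  0 < s -> 0 < t ->
  \sum_(0 <= x < M + s) \sum_(0 <= y < N + t) ~~ forced R M N x y =
    #|NW R| + #|SW R| + #|NE R| + #|SE R|.
Proof.
move=> le_sM le_tN rowR colR s_gt0 t_gt0.
have s_lt : s.-1 < s by lia.
have t_lt : t.-1 < t by lia.
(* The row bounds hold here for every 1-entry, so one in the first column (when [y < t]) or in the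
   last column (otherwise) suffices. *)
have midx x y : s <= x < M -> y < N + t -> forced R M N x y.
  move=> bx yb; case: (ltnP y t) => ty.
    have [i Ri] := colR (Ordinal t_gt0) (or_introl erefl).
    apply/existsP; exists (i, Ordinal t_gt0); rewrite Ri /=.
    by have := ltn_ord i; lia.
  have [|i Ri] := colR (Ordinal t_lt); first by right => /=; lia.
  apply/existsP; exists (i, Ordinal t_lt); rewrite Ri /=.
  by have := ltn_ord i; lia.
have midy x y : x < M + s -> t <= y < N -> forced R M N x y.
  move=> xb yb; case: (ltnP x s) => sx.
    have [j Rj] := rowR (Ordinal s_gt0) (or_introl erefl).
    apply/existsP; exists (Ordinal s_gt0, j); rewrite Rj /=.
    by have := ltn_ord j; lia.
  have [|j Rj] := rowR (Ordinal s_lt); first by right => /=; lia.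
  apply/existsP; exists (Ordinal s_lt, j); rewrite Rj /=.
  by have := ltn_ord j; lia.
rewrite sum_two_ends // => [|x bx]; last first.
  by rewrite sum_nat0 // => y yb; rewrite midx.
have cols x : x < M + s -> \sum_(0 <= y < N + t) ~~ forced R M N x y =
    \sum_(j < t) (~~ forced R M N x j + ~~ forced R M N x (N + j)).
  by move=> x_lt; rewrite sum_two_ends // => y yb; rewrite midy.
under eq_bigr => i _ do rewrite !cols ?ltn_add2l ?ltn_addl //.
rewrite /NW /SW /NE /SE.
pose ge_nat : rel nat := fun a b => b <= a.
have ge_refl : reflexive ge_nat by exact: leqnn.
rewrite (card_corner R leqnn leqnn) (card_corner R ge_refl leqnn).
rewrite (card_corner R leqnn ge_refl) (card_corner R ge_refl ge_refl).
rewrite -!big_split /=; apply: eq_bigr => i _.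
rewrite -!big_split /=; apply: eq_bigr => j _.
have i_lt := ltn_ord i; have j_lt := ltn_ord j.
have corner x y (P : pred ('I_s * 'I_t)) :
    (forall p : 'I_s * 'I_t,
       (p.1 <= x <= M + p.1) && (p.2 <= y <= N + p.2) = P p) ->
    forced R M N x y = [exists p, R p.1 p.2 && P p].
  by move=> PE; apply: eq_existsb => p; rewrite PE.
rewrite (corner i j (fun q => (q.1 <= i) && (q.2 <= j)));
  last by move=> [k l] /=; lia.
rewrite (corner i (N + j) (fun q => (q.1 <= i) && (j <= q.2)));
  last by move=> [k l] /=; have := ltn_ord l; lia.
rewrite (corner (M + i) j (fun q => (i <= q.1) && (q.2 <= j)));
  last by move=> [k l] /=; have := ltn_ord k; lia.
rewrite (corner (M + i) (N + j) (fun q => (i <= q.1) && (j <= q.2)));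
  last by move=> [k l] /=; have := ltn_ord k; have := ltn_ord l; lia.
(* The blocks arrive as (NW + NE) + (SW + SE). *)
by rewrite addnACA !addnA.
Qed.

(** * Trimming to the core *)

Lemma zero_topP s t (Q : 'M[bool]_(s, t)) (i : 'I_s) :
  row_has_one Q i ->
  zero_top Q <= i /\
  exists2 i0 : 'I_s, row_has_one Q i0 & i0 = zero_top Q :> nat.
Proof.
move=> Qi; have hasQ : has (row_has_one Q) (enum 'I_s).
  by apply/hasP; exists i; rewrite ?mem_enum.
have ltQ := hasQ; rewrite has_find size_enum_ord in ltQ; split.
  (* Here [i] serves as the default of [nth], never reached since the index is in range. *)
  rewrite leqNgt; apply/negP => /(before_find i).
  by rewrite nth_ord_enum Qi.
by exists (Ordinal ltQ) => //; have := nth_find i hasQ;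
  rewrite -[find _ _]/(nat_of_ord (Ordinal ltQ)) nth_ord_enum.
Qed.

Lemma zero_bottomP s t (Q : 'M[bool]_(s, t)) (i : 'I_s) :
  row_has_one Q i ->
  i + zero_bottom Q < s /\
  exists2 i0 : 'I_s, row_has_one Q i0 & i0 + zero_bottom Q = s.-1.
Proof.
move=> Qi; have i_lt := ltn_ord i.
have hasQ : has (row_has_one Q) (rev (enum 'I_s)).
  by apply/hasP; exists i; rewrite ?mem_rev ?mem_enum.
have ltQ := hasQ; rewrite has_find size_rev size_enum_ord in ltQ; split.
  rewrite ltnNge; apply/negP => le_s.
  (* Row [i] sits at position [s - i.+1] of the reversed enumeration. *)
  have lt_find : s - i.+1 < find (row_has_one Q) (rev (enum 'I_s)).
    by move: le_s; rewrite /zero_bottom; lia.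
  have := before_find i lt_find; rewrite nth_rev size_enum_ord; last by lia.
  have -> : s - (s - i.+1).+1 = i by lia.
  by rewrite nth_ord_enum Qi.
have i0_lt : s - (zero_bottom Q).+1 < s by lia.
exists (Ordinal i0_lt); last by rewrite /= /zero_bottom; lia.
have := nth_find i hasQ; rewrite nth_rev size_enum_ord //.
by rewrite -[s - _]/(nat_of_ord (Ordinal i0_lt)) nth_ord_enum.
Qed.

(** A 1-entry keeps the zero blocks at opposite ends disjoint, so the truncated subtractions in
    [core_rows] and [core_cols] are exact. Columns are handled as rows of the transpose. *)
Lemma core_bounds s t (Q : 'M[bool]_(s, t)) i j :
  Q i j ->
  zero_top Q <= i < zero_top Q + core_rows Q /\
  zero_left Q <= j < zero_left Q + core_cols Q.
Proof.
move=> Qij; have Qi : row_has_one Q i by apply/existsP; exists j.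
have Qj : row_has_one Q^T%R j by apply/existsP; exists i; rewrite mxE.
have [top_i _] := zero_topP Qi; have [left_j _] := zero_topP Qj.
have [bot_i _] := zero_bottomP Qi.
have [right_j _] := zero_bottomP Qj.
by rewrite /core_rows /core_cols /zero_left /zero_right; lia.
Qed.

Lemma core_lift s t (Q : 'M[bool]_(s, t)) i j :
  Q i j -> exists i' j', [/\ core Q i' j', i = zero_top Q + i' :> nat
                           & j = zero_left Q + j' :> nat].
Proof.
move=> Qij; have [bi bj] := core_bounds Qij.
have i'P : i - zero_top Q < core_rows Q by lia.
have j'P : j - zero_left Q < core_cols Q by lia.
exists (Ordinal i'P), (Ordinal j'P).
split=> /=; [|lia|lia]; rewrite mxE.
suff [-> ->] : trim_ord (Ordinal i'P) = i /\ trim_ord (Ordinal j'P) = j by [].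
by split; apply: val_inj => /=; lia.
Qed.

(** Stated on [Q] rather than on [core Q], so that applying it to the transpose yields the column
    version. *)
Lemma row_has_one_ends s t (Q : 'M[bool]_(s, t)) i0 j0 k :
  Q i0 j0 -> k = 0 \/ k.+1 = core_rows Q ->
  exists i j, Q i j /\ i = zero_top Q + k :> nat.
Proof.
move=> Q0 kE; have Qi0 : row_has_one Q i0 by apply/existsP; exists j0.
have [_ [i1 /existsP[j1 Q1] i1E]] := zero_topP Qi0.
have [_ [i2 /existsP[j2 Q2] i2E]] := zero_bottomP Qi0.
have [b0 _] := core_bounds Q0; rewrite /core_rows in kE b0.
by case: kE => kE; [exists i1, j1 | exists i2, j2]; split=> //; lia.
Qed.

Lemma core_row_ends s t (Q : 'M[bool]_(s, t)) i0 j0 (i : 'I_(core_rows Q)) :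
  Q i0 j0 -> i = 0 :> nat \/ i.+1 = core_rows Q -> exists j, core Q i j.
Proof.
move=> Q0 /(row_has_one_ends Q0)[i1 [j1 [Q1 i1E]]].
have [i' [j' [Q' i'E _]]] := core_lift Q1.
by exists j'; suff -> : i = i' by []; apply: val_inj => /=; lia.
Qed.

Lemma core_col_ends s t (Q : 'M[bool]_(s, t)) i0 j0 (j : 'I_(core_cols Q)) :
  Q i0 j0 -> j = 0 :> nat \/ j.+1 = core_cols Q -> exists i, core Q i j.
Proof.
move=> Q0; have QT0 : Q^T%R j0 i0 by rewrite mxE.
move=> /(row_has_one_ends QT0)[j1 [i1 []]]; rewrite mxE => Q1 j1E.
have [i' [j' [Q' _ j'E]]] := core_lift Q1.
exists i'; suff -> : j = j' by []; apply: val_inj => /=.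
by rewrite /zero_left in j'E; lia.
Qed.

Lemma forced_window s t (Q : 'M[bool]_(s, t)) M N x y :
  forced Q M N x y ->
  zero_top Q <= x < zero_top Q + (M + core_rows Q) /\
  zero_left Q <= y < zero_left Q + (N + core_cols Q).
Proof.
case/existsP=> -[i j] /= /and3P[Qij bx yb].
by have [] := core_bounds Qij; lia.
Qed.

(** Shifting the position and the 1-entry by the same amount preserves the box inequalities, and
    trimming loses no 1-entry. *)
Lemma forced_core s t (Q : 'M[bool]_(s, t)) M N x y :
  forced Q M N (zero_top Q + x) (zero_left Q + y) = forced (core Q) M N x y.
Proof.
apply/existsP/existsP => -[[i j] /= /and3P[Qij bx yb]].
  have [i' [j' [Qij' iE jE]]] := core_lift Qij.
  by exists (i', j'); rewrite Qij' /=; lia.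
exists (trim_ord i, trim_ord j); rewrite mxE in Qij.
by apply/and3P; split=> //=; rewrite leq_add2l addnCA leq_add2l.
Qed.

Lemma sum_forced_core s t (Q : 'M[bool]_(s, t)) M N m n :
  zero_top Q + (M + core_rows Q) <= m ->
  zero_left Q + (N + core_cols Q) <= n ->
  \sum_(0 <= x < m) \sum_(0 <= y < n) forced Q M N x y =
  \sum_(0 <= x < M + core_rows Q) \sum_(0 <= y < N + core_cols Q)
     forced (core Q) M N x y.
Proof.
move=> le_m le_n; rewrite (sum_window le_m) => [|x nz].
  apply: eq_bigr => x _; rewrite (sum_window le_n) => [|y nz].
    by apply: eq_bigr => y _; rewrite forced_core.
  have : forced Q M N (zero_top Q + x) y by move: nz; case: forced.
  by case/forced_window.
apply: contraNT nz => x_out; apply/eqP/sum_nat0 => y _.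
by case fxy: forced => //; case: (forced_window fxy) => xb _;
  rewrite xb in x_out.
Qed.

(** * Complementary counting and conclusion *)

Lemma sum_bool_compl (b : nat -> nat -> bool) m n :
  \sum_(0 <= x < m) \sum_(0 <= y < n) b x y +
  \sum_(0 <= x < m) \sum_(0 <= y < n) ~~ b x y = m * n.
Proof.
rewrite -big_split /= -[m in RHS]subn0 -sum_nat_const_nat.
apply: eq_bigr => x _; rewrite -big_split /= -[n in RHS]subn0 -[RHS]muln1.
by rewrite -sum_nat_const_nat; apply: eq_bigr => y _; case: (b x y).
Qed.

Local Open Scope ring_scope.

Theorem theorem2 (s t m n : nat) (Q : 'M[bool]_(s, t)) :
  Q != const_mx false ->
  m%:Z - (s%:Z - (core_rows Q)%:Z) >= 2 * (core_rows Q)%:Z ->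
  n%:Z - (t%:Z - (core_cols Q)%:Z) >= 2 * (core_cols Q)%:Z ->
  (min_ones m n Q)%:Z =
    (m%:Z - (s%:Z - (core_rows Q)%:Z)) * (n%:Z - (t%:Z - (core_cols Q)%:Z))
    - (#|NW (core Q)|%:Z + #|SW (core Q)|%:Z
       + #|NE (core Q)|%:Z + #|SE (core Q)|%:Z).
Proof.
move=> Q_neq0 m_ge n_ge.
have [i0 [j0 Q0]] : exists i j, Q i j.
  have /existsP[i /existsP[j Qij]] : [exists i, exists j, Q i j].
    apply: contraNT Q_neq0 => /existsPn Q0; apply/eqP/matrixP => i j.
    by rewrite mxE; apply/negbTE; have /existsPn := Q0 i.
  by exists i, j.
have [bi bj] := core_bounds Q0.
have cr : (zero_top Q + core_rows Q <= s)%N by rewrite /core_rows in bi *; lia.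
have cc : (zero_left Q + core_cols Q <= t)%N by rewrite /core_cols in bj *; lia.
(* The size hypotheses say [s + core_rows Q <= m] and [t + core_cols Q <= n]: the natural
   subtractions [m - s] and [n - t] are exact, and large enough for the four corner blocks to be
   disjoint. *)
rewrite min_ones_forced; [|lia|lia].
rewrite sum_forced_core; [|lia|lia].
have := sum_bool_compl (forced (core Q) (m - s) (n - t))
          (m - s + core_rows Q) (n - t + core_cols Q).
rewrite sum_unforced; first last; [lia|lia| | |lia|lia|].
- by move=> j; apply: core_col_ends Q0.
- by move=> i; apply: core_row_ends Q0.
have -> : m%:Z - (s%:Z - (core_rows Q)%:Z) = (m - s + core_rows Q)%N%:Z by lia.
have -> : n%:Z - (t%:Z - (core_cols Q)%:Z) = (n - t + core_cols Q)%N%:Z by lia.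
by rewrite -PoszM => <-; lia.
Qed.
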